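(* Let $G=S_\infty$ and let $M,N\subseteq S(G)$ be minimal subflows. The following are equivalent: (1) $A^M=A^N$; (2) for all idempotents $u\in M$ and $v\in N$, the product $uv\in M$ is an idempotent.
   Context: View $S_\infty$ as the automorphism group of $\omega$ in the empty language, $\mathbf{A}_n=\{0,\dots,n-1\}$, $H_n$ the set of injections $n\to\omega$. $S(G)$ is the inverse limit of the spaces $\beta H_n$ along the continuous extensions of restriction maps, $\alpha(n)$ the $n$-th coordinate; right action: $S\in(\alpha g)(m)$ iff $\{x\in H_n:x\circ g|_m\in S\}\in\alpha(n)$ (for $n$ large); writing $\alpha\cdot f=(\alpha g)(m)$ for any $g$ extending $f\in H_m$, the semigroup product is $S\in(\alpha\gamma)(m)$ iff $\{f\in H_m:S\in\alpha\cdot f\}\in\gamma(m)$. Minimal subflows are the minimal right ideals; $u$ is idempotent if $uu=u$. For a closed $Y\subseteq S(G)$, $\mathcal{F}^Y_2=\{T\subseteq H_2:T\in\alpha(2)\ \forall\alpha\in Y\}$; $\phi:H_2\to[\omega]^2$ forgets the order, and $\phi(\mathcal{F})=\{T:\phi^{-1}(T)\in\mathcal{F}\}$. $\mathrm{LO}(\omega)$ is the set of linear orders on $\omega$. For $<_0,<_1\in\mathrm{LO}(\omega)$, $A(<_0,<_1)=\{\{a,b\}\in[\omega]^2:(a<_0b\iff a<_1b)\}$, and $A^M=\{(<_0,<_1)\in\mathrm{LO}(\omega)^2:A(<_0,<_1)\in\phi(\mathcal{F}^M_2)\}$. *)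

(* Defs.v *)
From mathcomp Require Import all_boot.
Unset Printing Implicit Defensive.

(* H_n : injections n -> omega, encoded as duplicate-free sequences of length n:
   x : H n corresponds to the injection i |-> nth 0 (val x) i. *)
Definition H (n : nat) : Type := {s : seq nat | (size s == n) && uniq s}.

Definition ultrafilter (T : Type) (U : (T -> Prop) -> Prop) : Prop :=
  [/\ U (fun _ => True), ~ U (fun _ => False),
      (forall A B, U A -> U B -> U (fun x => A x /\ B x)),
      (forall A B : T -> Prop, U A -> (forall x, A x -> B x) -> U B)
    & (forall A, U A \/ U (fun x => ~ A x))].

Definition fam : Type := forall n, (H n -> Prop) -> Prop.

Definition resp (m n : nat) (S : H m -> Prop) : H n -> Prop :=
  fun x => exists y : H m, S y /\ val y = take m (val x).

(* S(G): inverse limit of the beta H_n along the extended restriction maps. *)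
Definition SG (a : fam) : Prop :=
  (forall n, ultrafilter (H n) (a n)) /\
  (forall m n, m <= n -> forall S : H m -> Prop, a m S <-> a n (resp m n S)).

(* For f : m -> omega (a sequence of length m), the ultrafilter on H_m
   S in act a m f  iff  {x in H_n : x o f in S} in a(n), n large (f maps into n). *)
Definition act (a : fam) (m : nat) (f : seq nat) : (H m -> Prop) -> Prop :=
  fun S => exists n, all (fun k => k < n) f /\
    a n (fun x : H n => exists y : H m, S y /\ val y = map (fun k => nth 0 (val x) k) f).

Definition gact (a : fam) (g : nat -> nat) : fam :=
  fun m => act a m (map g (iota 0 m)).

Definition dot (a : fam) (m : nat) (f : H m) : (H m -> Prop) -> Prop := act a m (val f).

Definition sgprod (a c : fam) : fam :=
  fun m S => c m (fun f : H m => dot a m f S).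

Definition idem (u : fam) : Prop := sgprod u u = u.

(* Topology of S(G): basic clopen sets {a : S in a(n)}. *)
Definition closedSG (Y : fam -> Prop) : Prop :=
  forall a, SG a -> ~ Y a ->
    exists n (S : H n -> Prop), a n S /\ forall b, SG b -> b n S -> ~ Y b.

Definition subflow (Y : fam -> Prop) : Prop :=
  [/\ (forall a, Y a -> SG a), (exists a, Y a), closedSG Y &
      forall a (g : nat -> nat), bijective g -> Y a -> Y (gact a g)].

Definition minimal_subflow (Y : fam -> Prop) : Prop :=
  subflow Y /\
  forall Z, subflow Z -> (forall a, Z a -> Y a) -> forall a, Y a -> Z a.

Definition F2 (Y : fam -> Prop) : (H 2 -> Prop) -> Prop :=
  fun T => forall a, Y a -> a 2 T.

(* [omega]^2 as subsets of nat; phi forgets the order. *)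
Definition pair2 (a b : nat) : nat -> Prop := fun x => x = a \/ x = b.
Definition phi (x : H 2) : nat -> Prop := pair2 (nth 0 (val x) 0) (nth 0 (val x) 1).
Definition phiF (F : (H 2 -> Prop) -> Prop) : ((nat -> Prop) -> Prop) -> Prop :=
  fun T => F (fun x => T (phi x)).

Definition is_LO (R : nat -> nat -> Prop) : Prop :=
  [/\ (forall a, ~ R a a), (forall a b c, R a b -> R b c -> R a c)
    & (forall a b, a <> b -> R a b \/ R b a)].

Definition Aset (R0 R1 : nat -> nat -> Prop) : (nat -> Prop) -> Prop :=
  fun T => exists a b, a <> b /\ (forall x, T x <-> pair2 a b x) /\ (R0 a b <-> R1 a b).

Definition AM (Y : fam -> Prop) : (nat -> nat -> Prop) * (nat -> nat -> Prop) -> Prop :=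
  fun p => is_LO p.1 /\ is_LO p.2 /\ phiF (F2 Y) (Aset p.1 p.2).

(* Main.v *)
Require Import Defs.
From mathcomp Require Import all_boot boolp.
From mathcomp Require classical_sets filter.

(** An element a of S(G) acts on linear orders: R^a orders i before j iff R orders
    x(i) before x(j) for a-almost all x, and R^(ac) = (R^a)^c. A nonprincipal
    ultrafilter W gives an equivariant map rho : LO(omega) -> S(G), where rho(R)(n)
    is the iterated quantifier W x_1, ..., W x_n along {0,...,n-1} sorted by R;
    here R'^rho(R) is R or its reversal, according to whether W x, W y, R' x y.
    If M is a minimal subflow and c is in M, then R |-> c rho(R) has a closed
    invariant image in M, hence is onto M. So M has points [R]_M with
    R'^[R]_M = R reversed or not according to a sign eps_M(R'). Then A^M consists
    of the pairs of equal sign, [R]_M is idempotent iff eps_M(R) = +, and for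
    idempotents [R]_M, [S]_N the product [R]_M [S]_N is idempotent iff
    eps_N(R) = eps_M(S); the theorem is then a statement about signs. *)

(** * Ultrafilters as quantifiers *)

Section Ultrafilter.
Variables (T : Type) (U : (T -> Prop) -> Prop).
Hypothesis uU : ultrafilter T U.

Lemma ultraT (A : T -> Prop) : (forall x, A x) -> U A.
Proof. by case: uU => UT _ _ US _ hA; apply: (US _ _ UT). Qed.

Lemma ultraS (A B : T -> Prop) : (forall x, A x -> B x) -> U A -> U B.
Proof. by case: uU => _ _ _ US _ AB UA; apply: US UA AB. Qed.

Lemma ultraI (A B : T -> Prop) : U A -> U B -> U (fun x => A x /\ B x).
Proof. by case: uU => _ _ UI _ _; apply: UI. Qed.

Lemma ultraC (A : T -> Prop) : U (fun x => ~ A x) = ~ U A.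
Proof.
case: uU => _ U0 UI US UC; apply: propext; split=> [UnA UA|nUA].
  by apply: U0; apply: US (UI _ _ UA UnA) _ => x [].
by case: (UC A).
Qed.

Lemma ultra_ex (A : T -> Prop) : U A -> exists x, A x.
Proof.
case: uU => _ U0 _ US _ UA; apply: contrapT => nA; apply: U0.
by apply: US UA _ => x Ax; apply: nA; exists x.
Qed.

Lemma ultra_eq_on (A B C : T -> Prop) :
  U C -> (forall x, C x -> (A x <-> B x)) -> U A = U B.
Proof.
move=> UC AB; apply: propext; split=> UX; move: (ultraI _ _ UC UX);
by apply: ultraS => x [Cx]; case: (AB x Cx); auto.
Qed.

Lemma ultra_eq (A B : T -> Prop) : (forall x, A x <-> B x) -> U A = U B.
Proof. by move=> AB; congr U; apply: funext => x; apply: propext. Qed.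

Lemma ultra_const (P : Prop) : U (fun _ => P) = P.
Proof.
apply: propext; split=> [/ultra_ex[]//|p]; exact: ultraT.
Qed.

Lemma ultra_iff (A B : T -> Prop) : U (fun x => A x <-> B x) = (U A <-> U B).
Proof.
have [UA|nUA] := pselect (U A).
  rewrite (ultra_eq_on _ B A) //; first by apply: propext; tauto.
  by move=> x; tauto.
have UnA : U (fun x => ~ A x) by rewrite ultraC.
rewrite (ultra_eq_on _ (fun x => ~ B x) _ UnA) ?ultraC; last by move=> x; tauto.
by apply: propext; tauto.
Qed.

Lemma ultra_all (I : eqType) (s : seq I) (A : I -> T -> Prop) :
  (forall i, i \in s -> U (A i)) -> U (fun x => forall i, i \in s -> A i x).
Proof.
elim: s => [|i s IH] hA; first by apply: ultraT.
have /IH : forall j, j \in s -> U (A j) by move=> j js; apply: hA; rewrite inE js orbT.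
have /ultraI h : U (A i) by apply: hA; rewrite mem_head.
move=> /h; apply: ultraS => x [Ai As] j.
by rewrite inE => /predU1P[->//|/As].
Qed.

End Ultrafilter.

Lemma ultra_sum (T T' : Type) (U : (T -> Prop) -> Prop) (V : T -> (T' -> Prop) -> Prop) :
  ultrafilter T U -> (forall t, ultrafilter T' (V t)) ->
  ultrafilter T' (fun A => U (fun t => V t A)).
Proof.
move=> uU uV; split.
- by apply: ultraT => // t; apply: ultraT.
- move=> /(ultra_ex _ _ uU)[t]; by case: (uV t).
- move=> A B UA UB; apply: ultraS (ultraI _ _ uU _ _ UA UB) => // t [].
  exact: ultraI.
- move=> A B UA AB; apply: ultraS UA => // t; exact: ultraS.
- move=> A; have [?|?] := pselect (U (fun t => V t A)); first by left.
  by right; rewrite (ultra_eq _ _ _ (fun t => ~ V t A)) ?ultraC // => t; rewrite ultraC.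
Qed.

Lemma nonprincipal_ultrafilter :
  exists W, ultrafilter nat W /\ forall k, W (fun x => x <> k).
Proof.
(* [F] is the cofinite filter; an ultrafilter above it contains the complement of every point. *)
pose F (A : nat -> Prop) := exists n, forall k, n <= k -> A k.
have FF : filter.ProperFilter F.
  split; first by case=> n /(_ n (leqnn n)).
  split; first by exists 0.
  - move=> A B [n nA] [m mB]; exists (maxn n m) => k.
    by rewrite geq_max => /andP[/nA ? /mB].
  - by move=> A B AB [n nA]; exists n => k /nA /AB.
have [W [uW FW]] := filter.ultraFilterLemma FF.
have pW := filter.ultra_proper; exists W; split; last first.
  by move=> k; apply: FW; exists k.+1 => x kx ?; subst x; rewrite ltnn in kx.
split.
- exact: filter.filterT.
- exact: filter.filter_not_empty.
- move=> A B; exact: filter.filterI.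
- move=> A B WA AB; exact: filter.filterS WA.
- move=> A; exact: filter.in_ultra_setVsetC A uW.
Qed.

(** * Predicates of finite support and their evaluation at points of S(G) *)

Definition dep (D : seq nat) (P : (nat -> nat) -> Prop) : Prop :=
  forall h h', {in D, h =1 h'} -> P h -> P h'.

(** Turns translation into evaluation: [act a m f S] unfolds to [Ev a f (pull m f S)]. *)
Definition pull (m : nat) (f : seq nat) (S : H m -> Prop) : (nat -> nat) -> Prop :=
  fun h => exists y : H m, S y /\ val y = map h f.

(* Predicates on partial functions are modelled as predicates on nat -> nat; an
   x : H n is read as the function nth 0 (val x), which is junk beyond n, hence the
   hypothesis dep (iota 0 n) P in the lemmas on ev a n P. *)
Definition ev (a : fam) (n : nat) (P : (nat -> nat) -> Prop) : Prop :=
  a n (fun x => P (nth 0 (val x))).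

Definition Ev (a : fam) (f : seq nat) (P : (nat -> nat) -> Prop) : Prop :=
  exists n, all (fun k => k < n) f /\ ev a n P.

Lemma depE D P h h' : dep D P -> {in D, h =1 h'} -> P h = P h'.
Proof.
move=> dP hh; apply: propext; split; apply: dP => // i iD.
by rewrite hh.
Qed.

Lemma dep_sub D E P : {subset D <= E} -> dep D P -> dep E P.
Proof. by move=> DE dP h h' hh; apply: dP => i /DE /hh. Qed.

Lemma dep_pull m f S : dep f (pull m f S).
Proof.
move=> h h' hh [y [Sy yh]]; exists y; split=> //.
by rewrite yh; apply/eq_in_map.
Qed.

Lemma dep_comp D k P : dep D P -> dep (map k D) (fun h => P (h \o k)).
Proof. by move=> dP h h' hh; apply: dP => i iD; apply/hh/map_f. Qed.

Lemma pull_comp m f k S h : pull m f S (h \o k) = pull m (map k f) S h.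
Proof. by rewrite /pull map_comp. Qed.

Lemma bounded_seq (f : seq nat) : exists n, all (fun k => k < n) f.
Proof.
exists (\max_(i <- f) i).+1; apply/allP => i fi; rewrite ltnS.
by rewrite (big_rem i) //= leq_maxl.
Qed.

Lemma all_ltn_sub n (f : seq nat) : all (fun k => k < n) f -> {subset f <= iota 0 n}.
Proof. by move=> /allP fn i /fn; rewrite mem_iota. Qed.

Lemma H_wf n (x : H n) : size (val x) = n /\ uniq (val x).
Proof. by case: x => s /= /andP[/eqP-> ->]. Qed.

Lemma H_map_nth n (x : H n) : map (nth 0 (val x)) (iota 0 n) = val x.
Proof. by have [sx _] := H_wf n x; rewrite map_nth_iota0 ?sx // take_oversize ?sx. Qed.

Lemma resp_pull m n S (x : H n) : m <= n ->
  resp m n S x = pull m (iota 0 m) S (nth 0 (val x)).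
Proof.
by move=> lemn; have [sx _] := H_wf n x; rewrite /resp /pull map_nth_iota0 ?sx.
Qed.

Lemma uniq_map_H n (x : H n) f : all (fun k => k < n) f -> uniq f ->
  uniq (map (nth 0 (val x)) f).
Proof.
move=> /allP fn uf; have [sx ux] := H_wf n x.
rewrite map_inj_in_uniq // => i j /fn ilt /fn jlt /eqP.
by rewrite nth_uniq ?sx // => /eqP.
Qed.

Lemma pull_H n f h (P : (nat -> nat) -> Prop) :
  dep (iota 0 n) P -> size f = n -> uniq (map h f) ->
  pull n f (fun x => P (nth 0 (val x))) h = P (nth 0 (map h f)).
Proof.
move=> dP sf uhf; apply: propext; split=> [[y [Py <-//]]|Pf].
have wf : (size (map h f) == n) && uniq (map h f) by rewrite size_map sf eqxx.
by exists (Sub (map h f) wf); rewrite SubK.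
Qed.

Lemma nth_map_iota h n i : i \in iota 0 n -> nth 0 (map h (iota 0 n)) i = h i.
Proof.
by rewrite mem_iota /= add0n => lin; rewrite (nth_map 0) ?size_iota // nth_iota.
Qed.

(** Push-forward along a map that lands in [H m] only [U]-almost everywhere; the existential avoids
    choosing values elsewhere. *)
Lemma ultra_pull (T : Type) (U : (T -> Prop) -> Prop) m (f : T -> seq nat) :
  ultrafilter T U -> U (fun t => (size (f t) == m) && uniq (f t)) ->
  ultrafilter (H m) (fun S => U (fun t => exists y : H m, S y /\ val y = f t)).
Proof.
move=> uU wf; split.
- by apply: ultraS wf => // t wt; exists (Sub (f t) wt); rewrite SubK.
- by move=> /(ultra_ex _ _ uU)[t [y []]].
- move=> A B UA UB; apply: ultraS (ultraI _ _ uU _ _ UA UB) => // t.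
  move=> [[y [Ay yt]] [z [Bz zt]]]; exists y; split=> //; split=> //.
  by have -> : y = z by apply: val_inj; rewrite yt zt.
- move=> A B UA AB; apply: ultraS UA => // t [y [Ay yt]].
  by exists y; split=> //; apply: AB.
- move=> A; apply: contrapT => /not_orP[]; rewrite -ultraC // => nUA; apply.
  apply: ultraS (ultraI _ _ uU _ _ wf nUA) => // t [wt nA].
  exists (Sub (f t) wt); rewrite SubK; split=> // At.
  by apply: nA; exists (Sub (f t) wt); rewrite SubK.
Qed.

Section InverseLimit.
Variable a : fam.
Hypothesis SGa : SG a.

Lemma SG_ultra n : ultrafilter (H n) (a n).
Proof. by case: SGa. Qed.

Lemma SG_resp m n S : m <= n -> a m S = ev a n (pull m (iota 0 m) S).
Proof.
move=> lemn; case: (SGa) => _ /(_ m n lemn S) /propext->.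
by rewrite /ev; apply: ultra_eq => x; rewrite resp_pull.
Qed.

Lemma ev_mono m n P : dep (iota 0 m) P -> m <= n -> ev a m P = ev a n P.
Proof.
move=> dP lemn; rewrite {1}/ev (SG_resp m n) // /ev.
apply: ultra_eq => x; rewrite pull_H ?size_iota //; last first.
  apply: uniq_map_H; rewrite ?iota_uniq //.
  by apply/allP => i; rewrite mem_iota /= => /leq_trans->.
by rewrite (depE _ _ _ _ dP (nth_map_iota _ _)).
Qed.

(** The witness in [Ev] is immaterial: two bounds for [f] are compared at their maximum by
    [ev_mono]. *)
Lemma EvE f n P : dep f P -> all (fun k => k < n) f -> Ev a f P = ev a n P.
Proof.
move=> dP fn; apply: propext; split=> [[k [fk]]|]; last by exists n.
have dk := dep_sub _ _ _ (all_ltn_sub _ _ fk) dP.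
have dn := dep_sub _ _ _ (all_ltn_sub _ _ fn) dP.
by rewrite (ev_mono k (maxn k n)) ?leq_maxl // (ev_mono n (maxn k n)) ?leq_maxr.
Qed.

Lemma Ev_sub f e P : dep f P -> {subset f <= e} -> Ev a f P = Ev a e P.
Proof.
move=> dP fe; have [n en] := bounded_seq e.
rewrite !(EvE _ n) //; first exact: dep_sub dP.
by apply/allP => i /fe; apply: (allP en).
Qed.

Lemma act_ultra m (f : H m) : ultrafilter (H m) (act a m (val f)).
Proof.
have [n fn] := bounded_seq (val f).
have [sf uf] := H_wf m f.
have -> : act a m (val f) = fun S => a n (fun x => pull m (val f) S (nth 0 (val x))).
  apply: funext => S; exact: EvE (dep_pull _ _ _) fn.
apply: ultra_pull; first exact: SG_ultra.
apply: ultraT (SG_ultra n) _ _ => x; by rewrite size_map sf eqxx uniq_map_H.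
Qed.

End InverseLimit.

Lemma Ev_pull_H a n P (f : H n) : dep (iota 0 n) P ->
  act a n (val f) (fun x => P (nth 0 (val x))) =
  Ev a (map (nth 0 (val f)) (iota 0 n)) (fun h => P (h \o nth 0 (val f))).
Proof.
move=> dP; rewrite H_map_nth; have [sf uf] := H_wf n f.
apply: propext; split=> -[N [fN hN]]; exists N; split=> //; move: hN;
  rewrite (_ : a N _ = ev a N (fun h => P (h \o nth 0 (val f)))) //.
all: rewrite /ev; apply: ultra_eq => z; rewrite -/(pull n (val f) _ (nth 0 (val z))).
all: rewrite pull_H // ?uniq_map_H // (depE (iota 0 n) _ _ (nth 0 (val z) \o nth 0 (val f))) //.
all: by move=> i; rewrite mem_iota => /andP[_ iltn]; rewrite (nth_map 0) ?sf.
Qed.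

(** * The semigroup product as an iterated quantifier *)

Section Product.
Variables a c : fam.
Hypotheses (SGa : SG a) (SGc : SG c).

(** The product is a push-forward under composition: [k] is drawn from [c], then [h] from [a], and
    [P] is tested on [h \o k]. *)
Lemma ev_sgprod n P : dep (iota 0 n) P ->
  ev (sgprod a c) n P =
  ev c n (fun k => Ev a (map k (iota 0 n)) (fun h => P (h \o k))).
Proof.
move=> dP; rewrite /ev /sgprod; apply: ultra_eq => f.
by rewrite /dot Ev_pull_H.
Qed.

Lemma dep_Ev D P : dep D P ->
  dep D (fun k => Ev a (map k D) (fun h => P (h \o k))).
Proof.
move=> dP k k' kk' [N [kN hN]]; exists N; split.
  by have <- : map k D = map k' D by apply/eq_in_map.
move: hN; apply: ultraS (SG_ultra _ SGa N) _ _ _ => z; apply: dP => i iD /=.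
by rewrite kk'.
Qed.

Lemma Ev_map_sub D E k P : dep D P -> {subset D <= E} ->
  Ev a (map k E) (fun h => P (h \o k)) = Ev a (map k D) (fun h => P (h \o k)).
Proof.
move=> dP DE; apply/esym/Ev_sub => //; first exact: dep_comp.
by move=> _ /mapP[i iD ->]; apply/map_f/DE.
Qed.

Lemma iota_sub m n : m <= n -> {subset iota 0 m <= iota 0 n}.
Proof. by move=> lemn i; rewrite !mem_iota => /leq_trans->. Qed.

Lemma sgprod_pull m S :
  sgprod a c m S = ev c m (fun k => Ev a (map k (iota 0 m))
                                      (fun h => pull m (iota 0 m) S (h \o k))).
Proof.
rewrite /ev /sgprod; apply: ultra_eq => f; rewrite H_map_nth /dot.
suff -> : (fun h => pull m (iota 0 m) S (h \o nth 0 (val f))) = pull m (val f) S by [].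
by apply: funext => h; rewrite pull_comp H_map_nth.
Qed.

Lemma SG_sgprod : SG (sgprod a c).
Proof.
split=> [n|m n lemn S].
  by apply: ultra_sum (SG_ultra _ SGc n) _ => f; apply: act_ultra.
rewrite (_ : sgprod a c n _ = ev (sgprod a c) n (pull m (iota 0 m) S)); last first.
  by rewrite /ev; apply: ultra_eq => x; rewrite resp_pull.
have dm := dep_pull m (iota 0 m) S.
have dn := dep_sub _ _ _ (iota_sub _ _ lemn) dm.
rewrite sgprod_pull ev_sgprod // (ev_mono _ SGc m n) //; last exact: dep_Ev.
rewrite /ev.
suff -> : (fun x : H n => Ev a (map (nth 0 (val x)) (iota 0 m))
    (fun h => pull m (iota 0 m) S (h \o nth 0 (val x)))) =
  (fun x : H n => Ev a (map (nth 0 (val x)) (iota 0 n))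
    (fun h => pull m (iota 0 m) S (h \o nth 0 (val x)))) by [].
by apply: funext => x; rewrite (Ev_map_sub _ _ _ _ dm (iota_sub _ _ lemn)).
Qed.

Lemma Ev_sgprod D P : dep D P ->
  Ev (sgprod a c) D P = Ev c D (fun k => Ev a (map k D) (fun h => P (h \o k))).
Proof.
move=> dP; have [n Dn] := bounded_seq D.
have Dsub := all_ltn_sub _ _ Dn.
have SGac := SG_sgprod.
rewrite (EvE _ SGac _ n) // (EvE _ SGc _ n) //; last exact: dep_Ev.
rewrite ev_sgprod; last exact: dep_sub dP.
rewrite /ev; apply: ultra_eq => x.
by rewrite (Ev_map_sub _ _ _ _ dP Dsub).
Qed.

(** Associativity with a group element as last factor, so left multiplication by [a] is
    equivariant. *)
Lemma gact_sgprod g : injective g -> gact (sgprod a c) g = sgprod a (gact c g).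
Proof.
move=> gI; apply: functional_extensionality_dep => m; apply: funext => S.
set f := map g (iota 0 m).
have uf : uniq f by rewrite map_inj_uniq ?iota_uniq.
have sf : size f = m by rewrite size_map size_iota.
have [n fn] := bounded_seq f.
rewrite /gact -/f -[LHS]/(Ev _ f (pull m f S)) Ev_sgprod; last exact: dep_pull.
rewrite [RHS](_ : _ = Ev c f (pull m f (fun y => dot a m y S))) //.
rewrite !(EvE _ SGc _ n) //; [|exact: dep_pull|apply: dep_Ev; exact: dep_pull].
rewrite /ev; apply: ultra_eq => x.
have ux := uniq_map_H _ x _ fn uf.
have wf : (size (map (nth 0 (val x)) f) == m) && uniq (map (nth 0 (val x)) f).
  by rewrite size_map sf eqxx.
rewrite (_ : (fun h => _) = pull m (map (nth 0 (val x)) f) S); last first.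
  by apply: funext => h; rewrite pull_comp.
split=> [h|[y [h yx]]].
  by exists (Sub (map (nth 0 (val x)) f) wf); rewrite /dot !SubK.
by move: h; rewrite /dot yx.
Qed.

End Product.

(** * The right action of S(G) on linear orders *)

Definition lam (R : nat -> nat -> Prop) (a : fam) : nat -> nat -> Prop :=
  fun i j => Ev a [:: i; j] (fun h => R (h i) (h j)).

Lemma dep_rel (R : nat -> nat -> Prop) D i j :
  i \in D -> j \in D -> dep D (fun h => R (h i) (h j)).
Proof. by move=> iD jD h h' hh; rewrite !hh. Qed.

Lemma lamE R a n i j : SG a -> i < n -> j < n ->
  lam R a i j = ev a n (fun h => R (h i) (h j)).
Proof.
move=> SGa ilt jlt; rewrite /lam (EvE _ SGa _ n) //= ?ilt ?jlt //.
by apply: dep_rel; rewrite !inE eqxx ?orbT.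
Qed.

Lemma lam_LO R a : is_LO R -> SG a -> is_LO (lam R a).
Proof.
move=> [Ri Rt Rc] SGa; split=> [i|i j k|i j ij].
- rewrite (lamE _ _ i.+1) // => /(ultra_ex _ _ (SG_ultra _ SGa _))[x]; exact: Ri.
- have [n /= /and4P[ilt jlt klt _]] := bounded_seq [:: i; j; k].
  rewrite !(lamE _ _ n) // /ev => hij hjk.
  have un := SG_ultra _ SGa n; apply: ultraS (ultraI _ _ un _ _ hij hjk) => //.
  by move=> x [] /Rt; apply.
- have [n /= /and3P[ilt jlt _]] := bounded_seq [:: i; j].
  rewrite !(lamE _ _ n) //.
  have un := SG_ultra _ SGa n; have [h|nR] := pselect (ev a n (fun h => R (h i) (h j))).
    by left.
  right; move: nR; rewrite /ev -ultraC //; apply: ultraS => // x nR.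
  case: (Rc (nth 0 (val x) i) (nth 0 (val x) j)) => // /eqP.
  have [sx ux] := H_wf n x; by rewrite nth_uniq ?sx // => /eqP.
Qed.

Lemma lam_sgprod R a c : SG a -> SG c ->
  lam R (sgprod a c) = lam (lam R a) c.
Proof.
move=> SGa SGc; apply/funext => i; apply/funext => j.
by rewrite /lam Ev_sgprod //; apply: dep_rel; rewrite !inE eqxx ?orbT.
Qed.

(** * Subflows are right ideals *)

Lemma swap_bijective (p q : nat) :
  bijective (fun x => if x == p then q else if x == q then p else x).
Proof.
apply: inv_bij => x.
have [->|xp] := eqVneq x p; first by have [->|] := eqVneq q p; rewrite ?eqxx.
by have [->|xq] := eqVneq x q; rewrite ?eqxx // (negPf xp) (negPf xq).
Qed.

(** Appending [x] costs one transposition, of [x] with the value of [g] at the new index; the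
    earlier values are neither of these two. *)
Lemma uniq_bijection (f : seq nat) : uniq f ->
  exists g : nat -> nat, bijective g /\ map g (iota 0 (size f)) = f.
Proof.
elim/last_ind: f => [_|f x IH]; first by exists id; split=> //; exists id.
rewrite rcons_uniq => /andP[xf uf]; have [g [gb gf]] := IH uf.
exists ((fun y => if y == g (size f) then x else if y == x then g (size f) else y) \o g).
split; first by apply: bij_comp => //; apply: swap_bijective.
rewrite size_rcons -addn1 iotaD map_cat /= add0n eqxx cats1; congr rcons.
rewrite -[RHS]gf; apply/eq_in_map => i iin /=.
have gif : g i \in f by rewrite -gf map_f.
move: iin; rewrite mem_iota /= add0n => ilt.
rewrite (inj_eq (bij_inj gb)) ltn_eqF //.
by case: eqP => // gix; rewrite -gix gif in xf.
Qed.

(** Translates of [a] approximate the product: if a basic clopen set around it missed [Y], some [f]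
    in [H n] would put the translate of [a] by [f] in that set, and a permutation extending [f]
    would give a point of [Y] there. *)
Lemma subflow_sgprod Y a c : subflow Y -> Y a -> SG c -> Y (sgprod a c).
Proof.
move=> [YSG _ Ycl Yact] Ya SGc; apply: contrapT => nY.
have [n [S [hS]]] := Ycl _ (SG_sgprod _ _ (YSG _ Ya) SGc) nY.
have [f hf] := ultra_ex _ _ (SG_ultra _ SGc n) _ hS.
have [sf uf] := H_wf n f.
have [g [gb gf]] := uniq_bijection _ uf.
have Yg := Yact _ _ gb Ya.
move=> /(_ (gact a g) (YSG _ Yg)); apply=> //.
by rewrite /gact -[X in iota 0 X]sf gf.
Qed.

(** * Sorting finite lists by a linear order *)

Definition leo (R : nat -> nat -> Prop) : rel nat := fun x y => (x == y) || `[< R x y >].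

Section LinearOrder.
Variable R : nat -> nat -> Prop.
Hypothesis LO : is_LO R.

Lemma leo_total : total (leo R).
Proof.
case: LO => _ _ Rc x y; rewrite /leo eq_sym; have [//|/eqP xy] := eqVneq y x.
by apply/orP; case: (Rc y x xy) => h; [right|left]; apply/asboolP.
Qed.

Lemma leo_trans : transitive (leo R).
Proof.
case: LO => _ Rt _ y x z /orP[/eqP->//|/asboolP xy] /orP[/eqP<-|/asboolP yz].
  by apply/orP; right; apply/asboolP.
by apply/orP; right; apply/asboolP/Rt/yz.
Qed.

Lemma leo_anti : antisymmetric (leo R).
Proof.
case: LO => Ri Rt _ x y /andP[/orP[/eqP->//|/asboolP xy] /orP[/eqP->//|/asboolP yx]].
by case: (Ri x); apply: Rt yx.
Qed.

Lemma sort_leoP s t : reflect (sort (leo R) s = sort (leo R) t) (perm_eq s t).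
Proof. exact: perm_sortP leo_total leo_trans leo_anti s t. Qed.

Lemma filter_sort_leo D E : uniq D -> uniq E -> {subset D <= E} ->
  filter (mem D) (sort (leo R) E) = sort (leo R) D.
Proof.
move=> uD uE DE; rewrite (filter_sort leo_total leo_trans).
apply/sort_leoP/uniq_perm => [||i]; rewrite ?filter_uniq //.
by rewrite mem_filter /=; apply: andb_idr => /DE.
Qed.

Lemma comp_LO g : injective g -> is_LO (fun x y => R (g x) (g y)).
Proof.
move=> gI; case: LO => Ri Rt Rc; split=> [a|a b c|a b ab]; first exact: Ri.
  exact: Rt.
by apply: Rc => /gI.
Qed.

End LinearOrder.

Lemma eq_sort_leo R R' s : is_LO R -> is_LO R' ->
  {in s &, forall i j, R i j <-> R' i j} -> sort (leo R) s = sort (leo R') s.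
Proof.
move=> LR LR' RR'.
rewrite -(sorted_sort (leo_trans _ LR') (s := sort (leo R) s)).
  by apply/(sort_leoP _ LR'); rewrite perm_sort.
rewrite -(@eq_in_sorted _ (mem s) (leo R)) ?sort_sorted //; first exact: leo_total.
- by move=> i j ss js; rewrite /leo; congr orb; apply: asbool_equiv_eq; apply: RR'.
- by apply/allP => i; rewrite mem_sort.
Qed.

(** * The equivariant map from linear orders to S(G) *)

Section IteratedUltrafilter.
Variable W : (nat -> Prop) -> Prop.
Hypotheses (uW : ultrafilter nat W) (W_neq : forall k, W (fun x => x <> k)).

Definition upd (h : nat -> nat) (a x : nat) : nat -> nat :=
  fun i => if i == a then x else h i.

(* The iterated quantifier "W x_1, ..., W x_n", with x_i the value of the function
   at the i-th entry of the list. Its restriction to a sublist is the iterated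
   quantifier along the sublist, so no Ramsey argument is needed. *)
Fixpoint Wq (l : seq nat) (P : (nat -> nat) -> Prop) (h : nat -> nat) : Prop :=
  if l is a :: l' then W (fun x => Wq l' P (upd h a x)) else P h.

Lemma Wq_ultra l h : ultrafilter (nat -> nat) (fun P => Wq l P h).
Proof.
elim: l h => [|a l IH] h; last by apply: ultra_sum uW _ => x; apply: IH.
split=> //=; first by move=> A B ? AB; apply: AB.
by move=> A; apply: EM.
Qed.

Lemma Wq_init D l P h h' : dep D P ->
  {in D, forall i, i \notin l -> h i = h' i} -> Wq l P h = Wq l P h'.
Proof.
move=> dP; elim: l h h' => [|a l IH] h h' hh /=.
  by apply: (depE _ _ _ _ dP) => i iD; apply: hh.
congr W; apply: funext => x; apply: IH => i iD il; rewrite /upd.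
by case: eqVneq => // ia; apply: hh => //; rewrite inE negb_or ia.
Qed.

(** A quantifier over a coordinate outside [D] is vacuous, so [ultra_const] removes it. *)
Lemma Wq_filter D l P h : dep D P -> Wq (filter (mem D) l) P h = Wq l P h.
Proof.
move=> dP; elim: l h => //= a l IH h; case: ifPn => aD /=.
  by congr W; apply: funext => x; apply: IH.
rewrite IH -[LHS](ultra_const _ _ uW); congr W; apply: funext => x.
apply: (Wq_init D) => // i iD _; rewrite /upd.
by case: eqVneq iD => // ->; rewrite (negPf aD).
Qed.

Lemma Wq_map g l P h : injective g ->
  Wq (map g l) (fun k => P (k \o g)) h = Wq l P (h \o g).
Proof.
move=> gI; elim: l h => //= a l IH h; congr W; apply: funext => x.
rewrite IH; congr Wq; apply: funext => i.
by rewrite /upd /= (inj_eq gI).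
Qed.

Lemma Wq_uniq l h : uniq l -> Wq l (fun k => uniq (map k l)) h.
Proof.
(* The induction needs a list [F] of forbidden values, and the fact that coordinates outside [l]
   keep their value. *)
move=> ul; suff: forall F : seq nat, Wq l (fun k => [/\ uniq (map k l),
    (forall i, i \in l -> k i \notin F) & forall i, i \notin l -> k i = h i]) h.
  by move=> /(_ [::]); apply: ultraS (Wq_ultra l h) _ _ _ => k [].
elim: l h ul => [//|a l IH] h /= /andP[al ul] F.
(* Nonprincipality lets [x] avoid [F]; the remaining coordinates must then avoid [x :: F]. *)
have := ultra_all _ _ uW _ F (fun k x => x <> k) (fun k _ => W_neq k).
apply: ultraS => // x xF.
apply: ultraS (Wq_ultra l _) _ _ _ (IH (upd h a x) ul (x :: F)).
move=> k [uk kF kh]; have ka : k a = x by rewrite kh // /upd eqxx.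
split=> [|i|i].
- rewrite uk andbT; apply/mapP => -[i il]; rewrite ka => xi.
  by have := kF i il; rewrite -xi mem_head.
- rewrite inE => /predU1P[->|/kF]; last by rewrite inE negb_or => /andP[].
  by rewrite ka; apply/negP => /xF.
- by rewrite inE negb_or => /andP[ia il]; rewrite kh // /upd (negPf ia).
Qed.

(** The initial assignment [id] is a placeholder: all coordinates in [D] are overwritten. *)
Definition Wo (R : nat -> nat -> Prop) (D : seq nat) (P : (nat -> nat) -> Prop) : Prop :=
  Wq (sort (leo R) D) P id.

Lemma Wo_ultra R D : ultrafilter (nat -> nat) (Wo R D).
Proof. exact: Wq_ultra. Qed.

Lemma Wo_uniq R D : uniq D -> Wo R D (fun k => uniq (map k D)).
Proof.
move=> uD; have := Wq_uniq (sort (leo R) D) id; rewrite sort_uniq => /(_ uD).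
apply: ultraS (Wo_ultra R D) _ _ _ => k.
by rewrite (perm_uniq (perm_map k (permEl (perm_sort (leo R) D)))).
Qed.

Lemma Wo_sub R D E P : is_LO R -> dep D P -> uniq D -> uniq E ->
  {subset D <= E} -> Wo R E P = Wo R D P.
Proof.
by move=> LO dP uD uE DE; rewrite /Wo -(Wq_filter D) // filter_sort_leo.
Qed.

Lemma Wo_map R g D P : injective g -> dep D P ->
  Wo R (map g D) (fun k => P (k \o g)) = Wo (fun x y => R (g x) (g y)) D P.
Proof.
move=> gI dP; rewrite /Wo sort_map Wq_map //.
rewrite (_ : (relpre g (leo R) : rel nat) = leo (fun x y => R (g x) (g y))); last first.
  by apply: funext => x; apply: funext => y; rewrite /leo /= (inj_eq gI).
by apply: (Wq_init D) => // i iD; rewrite mem_sort iD.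
Qed.

Definition rho (R : nat -> nat -> Prop) : fam :=
  fun n S => Wo R (iota 0 n) (pull n (iota 0 n) S).

(** The two sides can differ only at [h] not injective on [iota 0 n], and [Wo_uniq] makes these
    negligible. *)
Lemma ev_rho R n P : dep (iota 0 n) P -> ev (rho R) n P = Wo R (iota 0 n) P.
Proof.
move=> dP; apply: (ultra_eq_on _ _ (Wo_ultra R _) _ _ _ (Wo_uniq R _ (iota_uniq 0 n))).
move=> h uh; rewrite pull_H ?size_iota //.
by rewrite (depE _ _ _ _ dP (nth_map_iota _ _)).
Qed.

Lemma SG_rho R : is_LO R -> SG (rho R).
Proof.
move=> LO; split=> [n|m n lemn S].
  apply: ultra_pull (Wo_ultra R _) _.
  apply: ultraS (Wo_ultra R _) _ _ _ (Wo_uniq R _ (iota_uniq 0 n)) => h uh.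
  by rewrite size_map size_iota eqxx.
rewrite (_ : rho R n _ = ev (rho R) n (pull m (iota 0 m) S)); last first.
  by rewrite /ev; congr rho; apply: funext => x; rewrite resp_pull.
have dm := dep_pull m (iota 0 m) S; have smn := iota_sub _ _ lemn.
by rewrite ev_rho ?(Wo_sub _ (iota 0 m)) ?iota_uniq //; apply: dep_sub dm.
Qed.

Lemma Ev_rho R f P : is_LO R -> dep f P -> uniq f -> Ev (rho R) f P = Wo R f P.
Proof.
move=> LO dP uf; have [n fn] := bounded_seq f; have fs := all_ltn_sub _ _ fn.
rewrite (EvE _ (SG_rho _ LO) _ n) // ev_rho; last exact: dep_sub dP.
by rewrite (Wo_sub _ f) ?iota_uniq.
Qed.

Lemma gact_rho R g : is_LO R -> injective g ->
  gact (rho R) g = rho (fun x y => R (g x) (g y)).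
Proof.
move=> LO gI; apply: functional_extensionality_dep => m; apply: funext => S.
rewrite /gact -[LHS]/(Ev _ _ (pull m _ S)) Ev_rho //; last 2 first.
- exact: dep_pull.
- by rewrite map_inj_uniq ?iota_uniq.
rewrite /rho -(Wo_map R g) //; last exact: dep_pull.
by congr Wo; apply: funext => h; rewrite pull_comp.
Qed.

(** Continuity of [rho], in the form that will give a closed image. *)
Lemma rho_local R R' n : is_LO R -> is_LO R' ->
  {in iota 0 n &, forall i j, R i j <-> R' i j} -> rho R n = rho R' n.
Proof.
by move=> LR LR' RR'; apply: funext => S; rewrite /rho /Wo (eq_sort_leo _ R').
Qed.

Definition sgn (b : bool) (R : nat -> nat -> Prop) : nat -> nat -> Prop :=
  if b then R else fun x y => R y x.

Definition Wsgn (R : nat -> nat -> Prop) : bool := `[< W (fun x => W (fun y => R x y)) >].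

Lemma sgn_LO b R : is_LO R -> is_LO (sgn b R).
Proof.
case: b => // -[Ri Rt Rc]; split=> [a|a b c|a b ab] //=.
  by move=> ba cb; apply: Rt ba.
by case: (Rc a b ab); [right|left].
Qed.

Lemma sgnK b R : sgn b (sgn b R) = R.
Proof. by case: b. Qed.

Lemma LO_flip R i j : is_LO R -> i <> j -> R j i <-> ~ R i j.
Proof.
move=> [Ri Rt Rc] ij; split=> [ji ij'|nij]; first by apply: (Ri i); apply: Rt ji.
by case: (Rc i j ij).
Qed.

Lemma sgn_inj b c R : is_LO R -> sgn b R 0 1 <-> sgn c R 0 1 -> b = c.
Proof.
move=> LO; have h : R 1 0 <-> ~ R 0 1 by apply: LO_flip.
by case: b; case: c => //=; tauto.
Qed.

(** Off the diagonal, reversal is negation, which passes through both quantifiers; the diagonal is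
    negligible because [W] is nonprincipal. *)
Lemma Wsgn_flip R : is_LO R -> W (fun x => W (fun y => R y x)) = ~ Wsgn R.
Proof.
move=> LO; rewrite /Wsgn (asboolE _) -ultraC //; congr W; apply: funext => x.
rewrite -ultraC //; apply: (ultra_eq_on _ _ uW _ _ _ (W_neq x)) => y yx.
by apply: LO_flip => // xy; apply: yx.
Qed.

Lemma Wsgn_sgn b R : is_LO R -> Wsgn (sgn b R) = (b == Wsgn R).
Proof.
case: b => LO /=; first by case: Wsgn.
rewrite {1}/Wsgn /= Wsgn_flip //; case: Wsgn; last by rewrite asboolT.
by apply/negbTE/asboolPn => /(_ isT).
Qed.

(** Only the pair [i], [j] matters, and its [R]-smaller element is quantified first. If that is [i],
    the value is the sign of [R']; if it is [j], the arguments of [R'] are exchanged and [Wsgn_flip]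
    gives the negation. *)
Lemma lam_rho R' R : is_LO R' -> is_LO R -> lam R' (rho R) = sgn (Wsgn R') R.
Proof.
move=> LR' LR; have [Ri' _ _] := LR'; have [Ri _ Rc] := LR.
apply: funext => i; apply: funext => j.
have [ij|/eqP ij] := eqVneq i j.
  have [Rl _ _] := lam_LO _ _ LR' (SG_rho _ LR); have [Rs _ _] := sgn_LO (Wsgn R') _ LR.
  by rewrite ij; apply: propext; split=> [/Rl|/Rs].
rewrite /lam Ev_rho //; last 2 first.
- by apply: dep_rel; rewrite !inE eqxx ?orbT.
- by rewrite /= inE andbT; apply/eqP.
have ji : (j == i) = false by apply/eqP => e; apply: ij.
have [Rij|Rji] := Rc i j ij.
- rewrite /Wo sorted_sort; [|exact: leo_trans|by rewrite /= andbT /leo orbC asboolT].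
  have nRji : R j i <-> ~ R i j := LO_flip _ _ _ LR ij.
  rewrite /= /upd eqxx eq_sym ji eqxx.
  rewrite -(asboolE (W _)) -/(Wsgn R') /sgn.
  by case: (Wsgn R'); apply: propext; split=> //; tauto.
- rewrite /Wo (_ : sort _ _ = sort (leo R) [:: j; i]); last first.
    by apply/(sort_leoP _ LR); rewrite (perm_catC [:: i] [:: j]).
  rewrite sorted_sort; [|exact: leo_trans|by rewrite /= andbT /leo orbC asboolT].
  have nRji : R j i <-> ~ R i j := LO_flip _ _ _ LR ij.
  rewrite /= /upd eqxx ji eqxx Wsgn_flip // /sgn.
  by case: (Wsgn R'); apply: propext; split=> //; tauto.
Qed.

End IteratedUltrafilter.

(** * Coordinates on a minimal subflow *)

Lemma lam_sgn b R a : SG a -> lam (sgn b R) a = sgn b (lam R a).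
Proof.
move=> SGa; case: b => //=; apply: funext => i; apply: funext => j.
have [n /= /and3P[ilt jlt _]] := bounded_seq [:: i; j].
by rewrite !(lamE _ _ n).
Qed.

Lemma ltn_LO : is_LO (fun i j => i < j).
Proof.
split=> [a|a b c|a b /eqP]; first by rewrite ltnn.
  exact: ltn_trans.
by rewrite neq_ltn => /orP.
Qed.

(** Inclusion of [a n] in [b n] for all [n] already forces equality, by taking complements. *)
Lemma SG_neq a b : SG a -> SG b -> a <> b -> exists n S, a n S /\ ~ b n S.
Proof.
move=> SGa SGb; apply: contra_notP => /forallNP hab.
apply: functional_extensionality_dep => n; apply: funext => S.
have sub T : a n T -> b n T by move=> aT; apply: contrapT => nbT; apply: (hab n); exists T.
apply: propext; split=> [/sub//|bS]; apply: contrapT.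
by rewrite -ultraC; [move/sub; rewrite ultraC //; apply: SG_ultra|apply: SG_ultra].
Qed.

(* A minimal subflow is a copy of LO(omega) on which every R' acts, through lam, as
   either the identity or the order reversal. *)
Definition coordinates (M : fam -> Prop) (pt : (nat -> nat -> Prop) -> fam)
    (eps : (nat -> nat -> Prop) -> bool) : Prop :=
  [/\ (forall R, is_LO R -> M (pt R)),
      (forall a, M a -> exists R, is_LO R /\ a = pt R),
      (forall R' R, is_LO R' -> is_LO R -> lam R' (pt R) = sgn (eps R') R)
    & (forall b R, is_LO R -> eps (sgn b R) = (b == eps R))].

Lemma minimal_coordinates M : minimal_subflow M -> exists pt eps, coordinates M pt eps.
Proof.
move=> [Mflow Mmin]; have [MSG [c Mc] _ _] := Mflow; have SGc := MSG _ Mc.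
have [W [uW W_neq]] := nonprincipal_ultrafilter.
pose pt R := sgprod c (rho W R); pose eps R := Wsgn W (lam R c).
have SGr R : is_LO R -> SG (rho W R) by apply: SG_rho.
have Mpt R : is_LO R -> M (pt R) by move=> LO; apply: subflow_sgprod => //; apply: SGr.
have lam_pt R' R : is_LO R' -> is_LO R -> lam R' (pt R) = sgn (eps R') R.
  move=> LR' LR; rewrite lam_sgprod ?lam_rho //; [exact: lam_LO|exact: SGr].
exists pt, eps; split=> //; last first.
  by move=> b R LO; rewrite /eps lam_sgn // (Wsgn_sgn W) //; apply: lam_LO.
(* By minimality, surjectivity of [pt] onto [M] follows once its image is a subflow. *)
apply: (Mmin (fun a => exists R, is_LO R /\ a = pt R)); last first.
  by move=> a [R [LO ->]]; apply: Mpt.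
split.
- by move=> a [R [LO ->]]; apply/MSG/Mpt.
- by exists (pt (fun i j => i < j)), (fun i j => i < j); split=> //; apply: ltn_LO.
- move=> a SGa nZa; pose R' i j := i < j; have LR' : is_LO R' := ltn_LO.
  (* The only candidate preimage of [a]: if [a = pt R], then [lam_pt] at the test order [R']
     determines [R]. *)
  pose R := sgn (eps R') (lam R' a).
  have LR : is_LO R by apply/sgn_LO/lam_LO.
  have anR : a <> pt R by move=> aR; apply: nZa; exists R.
  have [n [S [aS nS]]] := SG_neq _ _ SGa (MSG _ (Mpt _ LR)) anR.
  (* The first conjunct separates [a] from [pt R]. The second makes any [R2] with [pt R2] in this
     set agree with [R] below [n], whence [pt R2 n = pt R n] by [rho_local], and this contradicts
     the first. *)
  exists n, (fun x : H n => S x /\ forall i, i \in iota 0 n -> forall j, j \in iota 0 n ->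
    R' (nth 0 (val x) i) (nth 0 (val x) j) <-> lam R' a i j).
  have ua := SG_ultra _ SGa n; split.
    apply: ultraI => //; apply: ultra_all => // i; rewrite mem_iota => /= ilt.
    apply: ultra_all => // j; rewrite mem_iota => /= jlt.
    by rewrite ultra_iff // ultra_const // (lamE _ _ n).
  move=> b SGb bT [R2 [LR2 bR2]]; have ub := SG_ultra _ SGb n.
  apply: nS; suff <- : b n = pt R n by apply: ultraS bT => // x [].
  have key i j : i \in iota 0 n -> j \in iota 0 n -> sgn (eps R') R2 i j <-> lam R' a i j.
    move=> iin jin; rewrite -lam_pt // -bR2.
    move: (iin) (jin); rewrite !mem_iota => /= ilt jlt.
    rewrite (lamE _ b n) // -[X in _ <-> X](ultra_const _ _ ub) /ev -ultra_iff //.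
    by apply: ultraS bT => // x [_ /(_ i iin j jin)].
  rewrite bR2 /pt /sgprod; apply: funext => T; rewrite (rho_local _ R2 R) // => i j iin jin.
  move: (key i j iin jin) (key j i jin iin); rewrite /R.
  by case: (eps R').
- move=> a g gb [R [LO ->]]; have gI := bij_inj gb.
  exists (fun x y => R (g x) (g y)); split; first exact: comp_LO.
  by rewrite /pt gact_sgprod ?gact_rho //; apply: SGr.
Qed.

(** * Idempotents and the set of pairs of orders in terms of signs *)

Section Coordinates.
Variables (M : fam -> Prop) (pt : (nat -> nat -> Prop) -> fam)
  (eps : (nat -> nat -> Prop) -> bool).
Hypotheses (Mflow : subflow M) (Mpt : coordinates M pt eps).

Let MSG a : M a -> SG a.
Proof. by case: Mflow => + _ _ _; apply. Qed.

(** A point of [M] is determined by its action on any single order, because [sgn b] is an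
    involution. *)
Lemma coordinates_inj a R' R : M a -> is_LO R' -> is_LO R ->
  lam R' a = sgn (eps R') R -> a = pt R.
Proof.
case: Mpt => _ surj lam_pt _ Ma LR' LR.
have [R2 [LR2 ->]] := surj a Ma; rewrite lam_pt // => e.
by rewrite -(sgnK (eps R') R2) e sgnK.
Qed.

(** The square of [pt R] always fixes [R], whereas [pt R] sends [R] to [sgn (eps R) R]. *)
Lemma idem_pt R : is_LO R -> idem (pt R) <-> eps R.
Proof.
move=> LR; case: (Mpt) => M_pt _ lam_pt eps_sgn; have Mu := M_pt _ LR.
have SGu := MSG _ Mu.
have uu : lam R (sgprod (pt R) (pt R)) = R.
  rewrite lam_sgprod // !lam_pt //; last exact: sgn_LO.
  by rewrite eps_sgn // eqxx.
split=> [id|eR].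
  have e : R = sgn (eps R) R by rewrite -{1}uu id lam_pt.
  by apply/esym/(sgn_inj _ _ R LR); rewrite -e.
by apply: (coordinates_inj _ R R) => //; [exact: subflow_sgprod|rewrite uu eR].
Qed.

(** Exchanging the two points negates both comparisons, so the equivalence does not depend on how
    the pair is listed. *)
Lemma Aset_phi R0 R1 (x : H 2) : is_LO R0 -> is_LO R1 ->
  Aset R0 R1 (phi x) <-> (R0 (nth 0 (val x) 0) (nth 0 (val x) 1) <->
                          R1 (nth 0 (val x) 0) (nth 0 (val x) 1)).
Proof.
move=> L0 L1; have [sx ux] := H_wf 2 x.
have : nth 0 (val x) 0 <> nth 0 (val x) 1 by move/eqP; rewrite nth_uniq ?sx.
rewrite /phi; move: (nth 0 _ 0) (nth 0 _ 1) => p q pq; split; last first.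
  by move=> h; exists p, q.
move=> [r [s [rs [e h]]]].
have fl0 := LO_flip _ _ _ L0 pq; have fl1 := LO_flip _ _ _ L1 pq.
case: ((e r).2 (or_introl erefl)) => er; case: ((e s).2 (or_intror erefl)) => es;
  rewrite er es // in rs h *; have [] := pselect (R0 p q); have [] := pselect (R1 p q); tauto.
Qed.

(** At [pt R] the condition compares [sgn (eps R0) R] with [sgn (eps R1) R] on the pair 0, 1.
    Testing at the usual order alone recovers equality of signs. *)
Lemma AM_eps R0 R1 : is_LO R0 -> is_LO R1 -> AM M (R0, R1) <-> eps R0 = eps R1.
Proof.
move=> L0 L1; case: (Mpt) => M_pt surj lam_pt _.
have key a : M a -> a 2 (fun x => Aset R0 R1 (phi x)) = (lam R0 a 0 1 <-> lam R1 a 0 1).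
  move=> Ma; have SGa := MSG _ Ma; rewrite !(lamE _ _ 2) // /ev.
  rewrite -ultra_iff; last exact: SG_ultra.
  by apply: ultra_eq => x; apply: Aset_phi.
split=> [[_ [_ A]]|e].
  have := A _ (M_pt _ ltn_LO); rewrite key; last exact/M_pt/ltn_LO.
  by rewrite !lam_pt //; try exact: ltn_LO; apply: sgn_inj ltn_LO.
split=> //; split=> // a Ma; rewrite key //; have [R [LR ->]] := surj _ Ma.
by rewrite !lam_pt // e.
Qed.

End Coordinates.

(** The first factor fixes [R], so the product sends [R] to [sgn (epsN R) S]; as [epsM R] holds,
    this is also its coordinate in [M], and [idem_pt] applies. *)
Lemma idem_sgprod M N ptM ptN epsM epsN R S :
  subflow M -> subflow N -> coordinates M ptM epsM -> coordinates N ptN epsN ->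
  is_LO R -> is_LO S -> epsM R ->
  idem (sgprod (ptM R) (ptN S)) <-> epsN R = epsM S.
Proof.
move=> FM FN CM CN LR LS eR.
have [M_pt _ lam_ptM eps_sgn] := CM; have [N_pt _ lam_ptN _] := CN.
have [MSG _ _ _] := FM; have [NSG _ _ _] := FN.
have SGu := MSG _ (M_pt _ LR); have SGv := NSG _ (N_pt _ LS).
have LS' : is_LO (sgn (epsN R) S) by apply: sgn_LO.
have -> : sgprod (ptM R) (ptN S) = ptM (sgn (epsN R) S).
  apply: (coordinates_inj _ _ _ CM _ R) => //.
    by apply: subflow_sgprod => //; apply: M_pt.
  by rewrite lam_sgprod // lam_ptM // eR /= lam_ptN.
rewrite (idem_pt _ _ _ FM CM) // eps_sgn //.
by split=> /eqP.
Qed.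

Theorem mainTheorem10 (M N : fam -> Prop) :
  minimal_subflow M -> minimal_subflow N ->
  (AM M = AM N <->
   (forall u v, M u -> idem u -> N v -> idem v ->
      idem (sgprod u v))).
Proof.
move=> minM minN; have [FM _] := minM; have [FN _] := minN.
have [ptM [epsM CM]] := minimal_coordinates _ minM.
have [ptN [epsN CN]] := minimal_coordinates _ minN.
have AM_M := AM_eps _ _ _ FM CM; have AM_N := AM_eps _ _ _ FN CN.
have [M_pt surjM _ sgnM] := CM; have [N_pt surjN _ sgnN] := CN.
split=> [AMN u v Mu iu Nv iv|h].
  have [R [LR uR]] := surjM u Mu; have [S [LS vS]] := surjN v Nv.
  move: iu iv; rewrite {}uR {}vS.
  rewrite (idem_pt _ _ _ FM CM) // (idem_pt _ _ _ FN CN) // => eR eS.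
  rewrite (idem_sgprod M N _ _ epsM epsN) //.
  (* With [epsM R] and [epsN S] both true, this says that [epsM S] holds exactly when [epsN R]
     does. *)
  have : epsM S = epsM R <-> epsN S = epsN R by rewrite -AM_M // -AM_N // AMN.
  by rewrite eR eS => -[]; case: (epsM S) => [->|_] //; case: (epsN R) => // /(_ erefl).
have eMN R S : is_LO R -> is_LO S -> epsM R -> epsN S -> epsN R = epsM S.
  move=> LR LS eR eS; apply/(idem_sgprod M N ptM ptN epsM epsN R S) => //.
  apply: h; [exact: M_pt|exact/(idem_pt _ _ _ FM CM)|exact: N_pt|].
  exact/(idem_pt _ _ _ FN CN).
suff e R0 R1 : is_LO R0 -> is_LO R1 -> epsM R0 = epsM R1 <-> epsN R0 = epsN R1.
  apply: funext => -[R0 R1]; apply: propext; split=> A; have [/= L0 [L1 _]] := A;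
  by move: A; rewrite AM_M // AM_N // e.
move=> L0 L1.
(* Replacing [R] by [sgn (epsM R) R] and [S] by [sgn (epsN S) S] makes both points idempotent, so
   [eMN] applies to arbitrary orders. Hence [epsM] and [epsN] agree on all linear orders or differ
   on all of them, and either way they identify the same pairs. *)
have c R S : is_LO R -> is_LO S -> (epsM R == epsN R) = (epsN S == epsM S).
  move=> LR LS; rewrite -sgnN // -sgnM //; apply: eMN; try exact: sgn_LO.
    by rewrite sgnM.
  by rewrite sgnN.
have := c R0 R1 L0 L1.
by case: (epsM R0); case: (epsM R1); case: (epsN R0); case: (epsN R1).
Qed.
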